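(* Let $X$ be a $C^*$-module over a $\Sigma^*$-algebra $\mathfrak{B}\subseteq B(\mathcal{H})$, and let $\mathscr{B}(X)$ be the WOT sequential closure of (the canonical image of) $X$ in $B(\mathcal{H}, X\otimes_{\mathfrak{B}}\mathcal{H})$. Then $\mathscr{B}(X)$, with the right $\mathfrak{B}$-action given by composition of operators, has a $\mathfrak{B}$-valued inner product making it into a $\Sigma^*$-module over $\mathfrak{B}$ that contains $X$ as a WOT$_{\mathfrak{B}}$ sequentially dense submodule and satisfies $$\langle \tau|x\rangle = \tau^*(x) \quad\text{for all } \tau\in\mathscr{B}(X),\ x\in X.$$ Moreover, the operator norm $\mathscr{B}(X)$ inherits from $B(\mathcal{H},X\otimes_{\mathfrak{B}}\mathcal{H})$ coincides with this $C^*$-module norm.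
   Context: WOT is the weak operator topology. A (concrete) $\Sigma^*$-algebra is a nondegenerate $C^*$-algebra $\mathfrak{B} \subseteq B(\mathcal{H})$ such that the limit in $B(\mathcal{H})$ of every WOT-convergent sequence in $\mathfrak{B}$ lies in $\mathfrak{B}$. A $C^*$-module over a $C^*$-algebra $A$ means a right Hilbert $C^*$-module, with $A$-valued inner product $\langle\cdot|\cdot\rangle$ linear and $A$-linear in the second variable and conjugate-linear in the first. $X\otimes_{\mathfrak{B}}\mathcal{H}$ is the Hilbert space completion of the algebraic module tensor product $X\odot_{\mathfrak{B}}\mathcal{H}$ for the inner product determined by $\langle x\otimes\zeta,y\otimes\eta\rangle=\langle\zeta,\langle x|y\rangle\eta\rangle$, and $X$ is canonically embedded in $B(\mathcal{H},X\otimes_{\mathfrak{B}}\mathcal{H})$ by $x(\zeta)=x\otimes\zeta$. A $C^*$-module $\mathfrak{X}$ over $\mathfrak{B}$ is a $\Sigma^*$-module if its canonical image in $B(\mathcal{H},\mathfrak{X}\otimes_{\mathfrak{B}}\mathcal{H})$ is WOT sequentially closed. The WOT sequential closure $\mathscr{B}(S)$ of $S$ is the smallest WOT sequentially closed subset (of the ambient operator space) containing $S$. For a sequence $(x_n)$ and $x$ in a $C^*$-module $\mathfrak{X}$ over $\mathfrak{B}$, $x_n\to x$ in WOT$_{\mathfrak{B}}$ means $\langle x_n|y\rangle\to\langle x|y\rangle$ WOT in $B(\mathcal{H})$ for all $y\in\mathfrak{X}$. A submodule $X$ of $\mathfrak{X}$ is WOT$_{\mathfrak{B}}$ sequentially dense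 if $\mathfrak{X}$ is the only subset of itself that contains $X$ and is closed under limits of WOT$_{\mathfrak{B}}$-convergent sequences. The space $B_{\mathfrak{B}}(X,\mathfrak{B})$ of bounded $\mathfrak{B}$-module maps is embedded isometrically in $B(X\otimes_{\mathfrak{B}}\mathcal{H},\mathcal{H})$ by $\varphi(x\otimes\zeta)=\varphi(x)\zeta$. For every $\tau\in\mathscr{B}(X)$, the Hilbert space adjoint $\tau^*$ lies in the image of this embedding, and $\tau^*(x)\in\mathfrak{B}$ denotes the value at $x$ of the corresponding module map, i.e. $\tau^*(x\otimes\zeta)=\tau^*(x)\zeta$ for all $\zeta\in\mathcal{H}$. *)

(* Defs.v *)
From HB Require Import structures.
From mathcomp Require Import all_boot all_order all_algebra.
From mathcomp Require Import complex.
From mathcomp Require Import all_classical all_reals all_analysis.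

Set Implicit Arguments.
Unset Strict Implicit.
Unset Printing Implicit Defensive.

Import Order.TTheory GRing.Theory Num.Theory.
Import numFieldNormedType.Exports.
Local Open Scope classical_set_scope.
Local Open Scope ring_scope.

Record hilbertType (R : realType) := HilbertType {
  hilbert_sort :> completeNormedModType R[i];
  hilbert_dot : {dot hilbert_sort for @Num.conj R[i]};
  hilbert_normE : forall x, `|x| ^+ 2 = hilbert_dot x x }.

(* The library's forms are linear in the first variable; the convention here is
   linearity in the second variable. *)
Definition hip (R : realType) (H : hilbertType R) (x y : H) : R[i] :=
  hilbert_dot H y x.

Definition subspace (R : realType) (V : lmodType R[i]) (D : set V) : Prop :=
  D 0 /\ forall (a : R[i]) x y, D x -> D y -> D (a *: x + y).

Definition lspan (R : realType) (V : lmodType R[i]) (S : set V) : set V :=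
  smallest (@subspace R V) S.

Section Operators.
Variables (R : realType) (H K : hilbertType R).

(* B(H, K), as a set of functions *)
Definition bounded_op : set (H -> K) :=
  [set T | (forall (a : R[i]) x y, T (a *: x + y) = a *: T x + T y) /\
           continuous T].

Definition opnorm (T : H -> K) : R :=
  sup [set complex.Re `|T x| | x in [set x : H | `|x| <= 1]].

Definition is_adjoint (T : H -> K) (S : K -> H) : Prop :=
  forall x y, hip (T x) y = hip x (S y).

Definition wot_cvg (u : nat -> H -> K) (T : H -> K) : Prop :=
  forall (x : H) (y : K),
    (fun n => hip y (u n x) : R[i]^o) @ \oo --> (hip y (T x) : R[i]^o).

Definition wot_seq_closed (D : set (H -> K)) : Prop :=
  D `<=` bounded_op /\
  forall (u : nat -> H -> K) (T : H -> K),
    (forall n, D (u n)) -> bounded_op T -> wot_cvg u T -> D T.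

Definition wot_seq_closure (S : set (H -> K)) : set (H -> K) :=
  smallest wot_seq_closed S.

End Operators.

Section Algebras.
Variables (R : realType) (H : hilbertType R).

Record is_cstar_algebra (B : set (H -> H)) : Prop := {
  cstar_bounded : B `<=` @bounded_op R H H;
  cstar_subspace : subspace B;
  cstar_mul : forall b c, B b -> B c -> B (b \o c);
  cstar_adjoint : forall b, B b -> exists2 c, B c & is_adjoint b c;
  cstar_norm_closed : forall (u : nat -> H -> H) (T : H -> H),
    (forall n, B (u n)) -> bounded_op T ->
    opnorm (u n - T) @[n --> \oo] --> (0 : R) -> B T }.

Definition nondegenerate_alg (B : set (H -> H)) : Prop :=
  dense (lspan [set y : H | exists2 b, B b & exists x, y = b x]).

Definition is_sigma_algebra (B : set (H -> H)) : Prop :=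
  [/\ is_cstar_algebra B, nondegenerate_alg B & wot_seq_closed B].

End Algebras.

(* The carrier of a C*-module is a subset D of an ambient complex vector space;
   the operations are only constrained on D.  This allows the set of operators
   BX of the statement to be a C*-module without building a subtype first. *)
Section Modules.
Variables (R : realType) (H : hilbertType R) (B : set (H -> H)).

Definition cstar_norm (V : lmodType R[i]) (ip : V -> V -> H -> H) (x : V) : R :=
  Num.sqrt (opnorm (ip x x)).

Record is_cstar_module (V : lmodType R[i]) (D : set V)
    (act : V -> (H -> H) -> V) (ip : V -> V -> H -> H) : Prop := {
  cmod_subspace : subspace D;
  cmod_act : forall x b, D x -> B b -> D (act x b);
  cmod_act_linl : forall (a : R[i]) x y b, D x -> D y -> B b ->
    act (a *: x + y) b = a *: act x b + act y b;
  cmod_act_linr : forall (a : R[i]) x b c, D x -> B b -> B c ->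
    act x (a *: b + c) = a *: act x b + act x c;
  cmod_actA : forall x b c, D x -> B b -> B c ->
    act (act x b) c = act x (b \o c);
  cmod_ip : forall x y, D x -> D y -> B (ip x y);
  cmod_ip_lin : forall (a : R[i]) x y z, D x -> D y -> D z ->
    ip x (a *: y + z) = a *: ip x y + ip x z;
  cmod_ip_act : forall x y b, D x -> D y -> B b ->
    ip x (act y b) = ip x y \o b;
  cmod_ip_adj : forall x y, D x -> D y -> is_adjoint (ip x y) (ip y x);
  cmod_ip_ge0 : forall x, D x -> forall h, 0 <= hip h (ip x x h);
  cmod_ip_eq0 : forall x, D x -> ip x x = 0 -> x = 0;
  cmod_complete : forall u : nat -> V, (forall n, D (u n)) ->
    (forall e : R, 0 < e -> exists N, forall m n, (N <= m)%N -> (N <= n)%N ->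
       cstar_norm ip (u m - u n) < e) ->
    exists2 x, D x & cstar_norm ip (u n - x) @[n --> \oo] --> (0 : R) }.

(* (K, t) is a Hilbert space completion of the algebraic module tensor product
   of D and H over B, with t x h the class of the elementary tensor: t is
   bilinear and B-balanced, hence factors through the algebraic tensor product;
   the induced map preserves the inner product and has dense range.  This
   determines (K, t) up to a unique unitary.  The canonical image of x in
   B(H, K) is the partial application t x. *)
Record is_tensor (V : lmodType R[i]) (D : set V) (act : V -> (H -> H) -> V)
    (ip : V -> V -> H -> H) (K : hilbertType R) (t : V -> H -> K) : Prop := {
  tensor_linl : forall (a : R[i]) x y h, D x -> D y ->
    t (a *: x + y) h = a *: t x h + t y h;
  tensor_linr : forall (a : R[i]) x h k, D x ->
    t x (a *: h + k) = a *: t x h + t x k;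
  tensor_balanced : forall x b h, D x -> B b -> t (act x b) h = t x (b h);
  tensor_ip : forall x y h k, D x -> D y ->
    hip (t x h) (t y k) = hip h (ip x y k);
  tensor_dense : dense (lspan [set z : K | exists2 x, D x & exists h, z = t x h]) }.

(* A completion always exists and is unique up to unitary; the clause asserting
   existence keeps the quantification over all completions from being vacuous. *)
Definition is_sigma_module (V : lmodType R[i]) (D : set V)
    (act : V -> (H -> H) -> V) (ip : V -> V -> H -> H) : Prop :=
  [/\ is_cstar_module D act ip,
      exists (K : hilbertType R) (t : V -> H -> K), is_tensor D act ip t &
      forall (K : hilbertType R) (t : V -> H -> K),
        is_tensor D act ip t -> wot_seq_closed [set t x | x in D]].

Definition wotB_cvg (V : lmodType R[i]) (D : set V) (ip : V -> V -> H -> H)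
    (u : nat -> V) (x : V) : Prop :=
  forall y, D y -> wot_cvg (fun n => ip (u n) y) (ip x y).

Definition wotB_seq_dense (V : lmodType R[i]) (D : set V)
    (ip : V -> V -> H -> H) (X : set V) : Prop :=
  forall E : set V, X `<=` E -> E `<=` D ->
    (forall (u : nat -> V) (x : V), (forall n, E (u n)) -> D x ->
       wotB_cvg D ip u x -> E x) ->
    E = D.

Record is_submodule_embedding (V W : lmodType R[i])
    (D : set V) (actV : V -> (H -> H) -> V) (ipV : V -> V -> H -> H)
    (E : set W) (actW : W -> (H -> H) -> W) (ipW : W -> W -> H -> H)
    (f : V -> W) : Prop := {
  emb_sub : forall x, D x -> E (f x);
  emb_inj : forall x y, D x -> D y -> f x = f y -> x = y;
  emb_lin : forall (a : R[i]) x y, D x -> D y ->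
    f (a *: x + y) = a *: f x + f y;
  emb_act : forall x b, D x -> B b -> f (actV x b) = actW (f x) b;
  emb_ip : forall x y, D x -> D y -> ipW (f x) (f y) = ipV x y }.

End Modules.

(* Main.v *)
Require Import Defs.
From mathcomp Require Import all_boot all_order all_algebra.
From mathcomp Require Import complex.
From mathcomp Require Import all_classical all_reals all_analysis.
From mathcomp Require Import ring lra.

Set Implicit Arguments.
Unset Strict Implicit.
Unset Printing Implicit Defensive.

Import Order.TTheory GRing.Theory Num.Theory.
Import numFieldNormedType.Exports.
Local Open Scope classical_set_scope.
Local Open Scope ring_scope.
Local Open Scope complex_scope.

(** The inner product on the closure M of X is <T|U> := T^* U, where T^* is the
Hilbert space adjoint.  Everything rests on one observation: for a fixed bounded
operator S, each of the maps T |-> a T + S, T |-> T b, T |-> S^* T and T |-> T^* S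
is WOT sequentially continuous, the last one because <k, T^* S h> is the
conjugate of <S h, T k>.  The set of those T in M whose image lies in a given
WOT sequentially closed set is therefore closed under the limits that build M,
and it is all of M as soon as it contains X ([wot_closure_ind]).  For operations
in two variables this is applied twice, first with one variable kept in X.
Hence M is a subspace ([wot_closure_subspace]) stable under the right action of
the algebra ([wot_closure_comp]), and T^* U lies in the algebra for all T and U
in M ([wot_closure_inner]), because x^* y = <x|y> does for x and y in X.

What remains holds for every WOT sequentially closed space M of operators from H
to K which is stable under the algebra, has M^* M inside the algebra, and whose
ranges span a dense subspace of K ([operator_sigma_module]).  The C*-identity
makes the module norm the operator norm ([opnorm_adjoint_comp]); M is complete
because norm limits are WOT limits; and K itself, with (T, h) |-> T h, is a model
of the tensor product of M and H.  For another model L there is an isometry U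
from K to L with U (T h) = T (x) h ([isometry_extension]); if the operators
induced by T_n in M converge WOT to S : H -> L, then T_n converges WOT to U^* S,
which is thus in M and induces S.

WOT sequential density of X in M is immediate: a WOT limit of elements of M is
also a limit in the topology tested by the inner products T^* y, by the
continuity of T |-> T^* y.

The existence of adjoints is the Riesz theorem [riesz], proved by minimising
|x|^2 - 2 Re (f x). *)

(** * Real-valued norms on complex normed modules *)

Section RealNorm.
Variables (R : realType) (V : normedModType R[i]).
Implicit Types (x y z : V).

(** The norm of a complex normed module takes its values in R[i]; this copy of it
is real, so that it can be fed to real arithmetic. *)
Definition nrm x : R := complex.Re `|x|.

Lemma nrmE x : `|x| = (nrm x)%:C.
Proof. by rewrite /nrm RRe_real // ger0_real. Qed.

Lemma nrm_ge0 x : 0 <= nrm x.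
Proof. by rewrite -ler0c -nrmE. Qed.

Lemma nrm0 : nrm (0 : V) = 0.
Proof. by rewrite /nrm normr0. Qed.

Lemma nrm_eq0 x : nrm x = 0 -> x = 0.
Proof. by move=> x0; apply/eqP; rewrite -normr_eq0 nrmE x0. Qed.

Lemma nrmD x y : nrm (x + y) <= nrm x + nrm y.
Proof. by rewrite -lecR rmorphD /= -!nrmE ler_normD. Qed.

Lemma nrmN x : nrm (- x) = nrm x.
Proof. by rewrite /nrm normrN. Qed.

Lemma nrm_distC x y : nrm (x - y) = nrm (y - x).
Proof. by rewrite -nrmN opprB. Qed.

Lemma nrm_dist_trans y x z : nrm (x - z) <= nrm (x - y) + nrm (y - z).
Proof. by rewrite -(subrKA y) nrmD. Qed.

Lemma nrmZ (a : R[i]) x : nrm (a *: x) = complex.Re `|a| * nrm x.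
Proof.
apply: (@complexI R); rewrite -nrmE normrZ nrmE rmorphM /=.
by rewrite RRe_real // ger0_real.
Qed.

Lemma nrm_gt0 x : x != 0 -> 0 < nrm x.
Proof.
by move=> x0; rewrite lt_def nrm_ge0 andbT; apply: contra_neq x0; exact: nrm_eq0.
Qed.

Lemma gt0_real_complex (e : R[i]) : 0 < e -> exists2 d : R, 0 < d & e = d%:C.
Proof.
move=> e0; exists (complex.Re e); last by rewrite RRe_real // gtr0_real.
by move: e0; rewrite ltcE => /andP[].
Qed.

Lemma cvg_nrmP (u : nat -> V) (l : V) :
  (u @ \oo --> l) <->
  (forall e : R, 0 < e -> exists N, forall n, (N <= n)%N -> nrm (u n - l) < e).
Proof.
split=> [/cvgrPdist_lt ul e e0|ul].
  have /ul [N _ Nul] : 0 < e%:C by rewrite ltcR.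
  by exists N => n /Nul /=; rewrite nrm_distC nrmE ltcR.
apply/cvgrPdist_lt => e /gt0_real_complex[d d0 ->].
have [N Nul] := ul _ d0.
by exists N => // n /Nul /=; rewrite nrm_distC nrmE ltcR.
Qed.

Lemma dense_nrm (D : set V) : dense D -> forall x (e : R), 0 < e ->
  exists2 y, D y & nrm (x - y) < e.
Proof.
move=> Dd x e e0; have e0' : 0 < e%:C by rewrite ltcR.
have [||y [yB Dy]] := Dd (ball x e%:C)^°.
- by exists x; apply: nbhsx_ballx.
- exact: open_interior.
exists y => //; move/interior_subset : yB.
by rewrite -ball_normE /ball_ /= nrmE ltcR.
Qed.

End RealNorm.

Lemma nrm_complete (R : realType) (V : completeNormedModType R[i]) (u : nat -> V) :
  (forall e : R, 0 < e -> exists N, forall m n, (N <= m)%N -> (N <= n)%N ->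
     nrm (u m - u n) < e) ->
  exists l : V, u @ \oo --> l.
Proof.
move=> uC; suff : cvgn u by move/(@cvg_ex V (u @ \oo)).
apply/cauchy_cvgP; apply: cauchy_exP => e /gt0_real_complex[d d0 ->].
have [N Nu] := uC _ d0; exists (u N); exists N => // n /= Nn.
by rewrite -ball_normE /ball_ /= nrmE ltcR Nu.
Qed.

Lemma lspan_sub (R : realType) (V : lmodType R[i]) (S P : set V) :
  Defs.subspace P -> S `<=` P -> lspan S `<=` P.
Proof. by move=> Psub SP; apply: smallest_sub. Qed.

Lemma lspan_mono (R : realType) (V : lmodType R[i]) (S S' : set V) :
  S `<=` S' -> lspan S `<=` lspan S'.
Proof.
move=> SS' x Sx D [Dsub S'D]; apply: Sx; split=> //.
exact: subset_trans S'D.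
Qed.

Lemma dense_mono (T : topologicalType) (D D' : set T) :
  D `<=` D' -> dense D -> dense D'.
Proof. by move=> DD' Dd O O0 Oo; have [x [Ox /DD' ?]] := Dd O O0 Oo; exists x. Qed.

(** * Inner products *)

Section Hilbert.
Variables (R : realType) (H : hilbertType R).
Implicit Types (x y z : H) (a : R[i]).

Lemma hipDr x y z : hip x (y + z) = hip x y + hip x z.
Proof. by rewrite /hip linearDl. Qed.
Lemma hipZr a x y : hip x (a *: y) = a * hip x y.
Proof. by rewrite /hip linearZl_LR. Qed.
Lemma hipC x y : hip x y = (hip y x)^*.
Proof. by rewrite /hip hermC /= expr0 mul1r. Qed.
Lemma hipDl x y z : hip (y + z) x = hip y x + hip z x.
Proof. by rewrite hipC hipDr rmorphD /= -!hipC. Qed.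
Lemma hipZl a x y : hip (a *: y) x = a^* * hip y x.
Proof. by rewrite hipC hipZr rmorphM /= -hipC. Qed.
Lemma hipBr x y z : hip x (y - z) = hip x y - hip x z.
Proof. by rewrite -scaleN1r hipDr hipZr mulN1r. Qed.
Lemma hipBl x y z : hip (y - z) x = hip y x - hip z x.
Proof. by rewrite hipC hipBr rmorphB /= -!hipC. Qed.
Lemma hip0r x : hip x 0 = 0.
Proof. by rewrite -(scale0r 0) hipZr mul0r. Qed.
Lemma hip0l x : hip 0 x = 0.
Proof. by rewrite hipC hip0r conjc0. Qed.

Lemma hip_nrm x : hip x x = (nrm x ^+ 2)%:C.
Proof. by rewrite /hip -hilbert_normE nrmE rmorphXn. Qed.

Lemma hip_eq0 x : hip x x = 0 -> x = 0.
Proof.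
by rewrite hip_nrm => -[/eqP]; rewrite expf_eq0 => /eqP; exact: nrm_eq0.
Qed.

(** The way equalities of vectors are obtained throughout: operators defined by
the Riesz theorem or by density are only known through their inner products. *)
Lemma hip_sep x y : (forall z, hip z x = hip z y) -> x = y.
Proof.
by move=> xy; apply/subr0_eq/hip_eq0; rewrite hipBr !xy subrr.
Qed.

(** The real inner product underlying the complex one. *)
Definition rip x y : R := complex.Re (hip x y).

Lemma ReD (v w : R[i]) : complex.Re (v + w) = complex.Re v + complex.Re w.
Proof. by case: v; case: w. Qed.

Lemma ripC x y : rip x y = rip y x.
Proof. by rewrite /rip hipC; case: (hip y x). Qed.
Lemma ripDr x y z : rip x (y + z) = rip x y + rip x z.
Proof. by rewrite /rip hipDr ReD. Qed.
Lemma ripZr (s : R) x y : rip x (s%:C *: y) = s * rip x y.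
Proof. by rewrite /rip hipZr; case: (hip x y) => ? ? /=; rewrite mul0r subr0. Qed.
Lemma rip_nrm x : nrm x ^+ 2 = rip x x.
Proof. by rewrite /rip hip_nrm. Qed.

Lemma nrm_sqD x y : nrm (x + y) ^+ 2 = nrm x ^+ 2 + 2 * rip x y + nrm y ^+ 2.
Proof.
by rewrite !rip_nrm !(ripDr, ripC (x + y)) (ripC y x); ring.
Qed.

Lemma nrm_sqZ (s : R) x : nrm (s%:C *: x) ^+ 2 = s ^+ 2 * nrm x ^+ 2.
Proof. by rewrite !rip_nrm ripZr ripC ripZr; ring. Qed.

(** Expand the square of the norm of |y| x - |x| y, which is nonnegative. *)
Lemma rip_le x y : rip x y <= nrm x * nrm y.
Proof.
have [x0|/eqP x0] := eqVneq (nrm x) 0.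
  by rewrite (nrm_eq0 x0) nrm0 mul0r ripC -(scale0r 0) -[0]/(0%:C) ripZr mul0r.
have [y0|/eqP y0] := eqVneq (nrm y) 0.
  by rewrite (nrm_eq0 y0) nrm0 mulr0 -(scale0r 0) -[0]/(0%:C) ripZr mul0r.
have {}x0 : 0 < nrm x by rewrite lt_def nrm_ge0 andbT; apply/eqP.
have {}y0 : 0 < nrm y by rewrite lt_def nrm_ge0 andbT; apply/eqP.
have := sqr_ge0 (nrm ((nrm y)%:C *: x + (- nrm x)%:C *: y)).
rewrite nrm_sqD !nrm_sqZ ripZr ripC ripZr (ripC y x) => h.
rewrite -(ler_pM2l (mulr_gt0 x0 y0)); nra.
Qed.

(** Replacing y by w^* y, with w = <x, y>, turns the inner product into the real
number |w|^2, which reduces the complex inequality to the real one. *)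
Lemma cauchy_schwarz x y : nrm (hip x y : R[i]^o) <= nrm x * nrm y.
Proof.
set w := hip x y.
have [->|w0] := eqVneq (nrm (w : R[i]^o)) 0; first by rewrite mulr_ge0 ?nrm_ge0.
have {}w0 : 0 < nrm (w : R[i]^o) by rewrite lt_def nrm_ge0 andbT.
rewrite -(ler_pM2l w0) mulrCA; apply: le_trans (_ : rip x (w^* *: y) <= _).
  have ww : w^* * w = (nrm (w : R[i]^o) ^+ 2)%:C.
    by rewrite rmorphXn /= -nrmE mulrC; apply/esym/normCK.
  by rewrite /rip hipZr ww /= expr2.
apply: le_trans (rip_le _ _) _; rewrite nrmZ.
have -> : `|w^*| = `|w| by exact: norm_conjC.
by rewrite mulrCA.
Qed.

End Hilbert.

(** * Limits in Hilbert spaces *)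

Section Limits.
Variables (R : realType).

Lemma eventually_inv_lt (e : R) : 0 < e ->
  exists N : nat, forall n, (N <= n)%N -> n.+1%:R^-1 < e.
Proof.
move=> e0; exists (Num.truncn e^-1) => n Nn.
rewrite -[ltRHS]invrK ltf_pV2 ?posrE ?invr_gt0 //.
by apply: lt_le_trans (truncnS_gt _) _; rewrite ler_nat ltnS.
Qed.

Lemma cvg_uniq (V : normedModType R[i]) (u : nat -> V) (l l' : V) :
  u @ \oo --> l -> u @ \oo --> l' -> l = l'.
Proof. by move=> ul ul'; apply: (cvg_unique _ ul ul'); exact: norm_hausdorff. Qed.

(** Scalars are a normed module over themselves only under the alias R[i]^o, which
has to be named in the statement. *)
Lemma cvgC_uniq (u : nat -> R[i]) (l l' : R[i]) :
  (u : nat -> R[i]^o) @ \oo --> (l : R[i]^o) ->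
  (u : nat -> R[i]^o) @ \oo --> (l' : R[i]^o) -> l = l'.
Proof. exact: cvg_uniq. Qed.

Lemma dense_cvg (V : normedModType R[i]) (D : set V) (x : V) : dense D ->
  exists2 u : nat -> V, (forall n, D (u n)) & u @ \oo --> x.
Proof.
move=> Dd.
have /choice[u uP] (n : nat) : exists y, D y /\ nrm (x - y) < n.+1%:R^-1.
  by have [|y Dy xy] := dense_nrm Dd x (e := n.+1%:R^-1); [rewrite invr_gt0|exists y].
exists u => [n|]; first by case: (uP n).
apply/cvg_nrmP => e /eventually_inv_lt[N Ne]; exists N => n /Ne.
by apply: le_lt_trans; rewrite nrm_distC; case: (uP n) => _ /ltW.
Qed.

Lemma cvg_conjc (u : nat -> R[i]) (l : R[i]) :
  (u : nat -> R[i]^o) @ \oo --> (l : R[i]^o) ->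
  ((fun n => (u n)^*) : nat -> R[i]^o) @ \oo --> (l^* : R[i]^o).
Proof.
move/cvg_nrmP => ul; apply/cvg_nrmP => e /ul[N Nu]; exists N => n /Nu.
suff -> : nrm ((u n)^* - l^* : R[i]^o) = nrm (u n - l : R[i]^o) by [].
by rewrite -rmorphB /nrm; congr (complex.Re _); exact: norm_conjC.
Qed.

End Limits.

Section HilbertLimits.
Variables (R : realType) (H : hilbertType R).

Lemma cvg_hipr (y : H) (u : nat -> H) (l : H) : u @ \oo --> l ->
  ((fun n => hip y (u n)) : nat -> R[i]^o) @ \oo --> (hip y l : R[i]^o).
Proof.
move/cvg_nrmP => ul; apply/cvg_nrmP => e e0.
have y0 : 0 < nrm y + 1 by rewrite ltr_wpDl ?nrm_ge0.
have [N Nu] := ul _ (divr_gt0 e0 y0); exists N => n /Nu.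
rewrite ltr_pdivlMr // -hipBr => h; apply: le_lt_trans (cauchy_schwarz _ _) _.
by have := nrm_ge0 (u n - l); nra.
Qed.

Lemma cvg_hipl (y : H) (u : nat -> H) (l : H) : u @ \oo --> l ->
  ((fun n => hip (u n) y) : nat -> R[i]^o) @ \oo --> (hip l y : R[i]^o).
Proof.
move=> /(@cvg_hipr y) /cvg_conjc; rewrite -hipC.
by under [X in X @ _]eq_fun do rewrite -hipC.
Qed.

Arguments cvg_hipr _ {u l}.
Arguments cvg_hipl _ {u l}.

Lemma dense_hip_ext (S : set H) (x y : H) : dense (lspan S) ->
  (forall s, S s -> hip s x = hip s y) -> x = y.
Proof.
move=> Sd Sxy; apply: hip_sep => z; have [u uS uz] := dense_cvg z Sd.
have ux n : hip (u n) x = hip (u n) y.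
  move: (u n) (uS n); apply: lspan_sub => //; split; first by rewrite /= !hip0l.
  by move=> a v w /= vE wE; rewrite !hipDl !hipZl vE wE.
apply: cvgC_uniq (cvg_hipl x uz) _.
by under [X in X @ _]eq_fun do rewrite ux; exact: cvg_hipl.
Qed.

End HilbertLimits.
Arguments cvg_hipr {R H} _ {u l}.
Arguments cvg_hipl {R H} _ {u l}.

(** * The Riesz representation theorem *)

Section Riesz.
Variables (R : realType) (H : hilbertType R).
Implicit Types (x y z : H).

(** If x minimises v |-> |v|^2 - 2 Re (f v) up to d, then <x, z> and f z have
almost equal real parts: otherwise a move along z would go below the infimum. *)
Lemma near_minimizer (f : H -> R[i]) (m d : R) x z :
  (forall (a : R[i]) u v, f (a *: u + v) = a * f u + f v) ->
  (forall v, m <= nrm v ^+ 2 - 2 * complex.Re (f v)) ->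
  nrm x ^+ 2 - 2 * complex.Re (f x) <= m + d ->
  (rip x z - complex.Re (f z)) ^+ 2 <= d * (1 + nrm z ^+ 2).
Proof.
move=> flin mJ xd; set p := rip x z - complex.Re (f z).
set q := 1 + nrm z ^+ 2.
have q1 : 1 <= q by rewrite lerDl sqr_ge0.
have q0 : 0 < q by lra.
(* The best step along z is - p / |z|^2; dividing by 1 + |z|^2 instead
   loses only a constant and covers z = 0. *)
have /= := mJ ((- p / q)%:C *: z + x).
rewrite flin nrm_sqD nrm_sqZ ripC ripZr ReD.
have -> : complex.Re ((- p / q)%:C * f z) = - p / q * complex.Re (f z).
  by case: (f z) => a b /=; rewrite mul0r subr0.
move=> h.
have {h}: - d <= (- p / q) ^+ 2 * nrm z ^+ 2 + 2 * (- p / q) * p.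
  by rewrite /p in h *; lra.
have -> : (- p / q) ^+ 2 * nrm z ^+ 2 + 2 * (- p / q) * p =
    - (p ^+ 2 * (q + 1)) / q ^+ 2.
  have -> : nrm z ^+ 2 = q - 1 by rewrite /q; ring.
  by field; lra.
rewrite ler_pdivlMr ?exprn_gt0 // => h.
have : p ^+ 2 * q <= d * q * q.
  have := sqr_ge0 p; nra.
by rewrite ler_pM2r.
Qed.

(** The imaginary part of f x is minus the real part of f (i x). *)
Lemma linear_eq_Re (f g : H -> R[i]) :
  (forall (a : R[i]) u v, f (a *: u + v) = a * f u + f v) ->
  (forall (a : R[i]) u v, g (a *: u + v) = a * g u + g v) ->
  (forall x, complex.Re (f x) = complex.Re (g x)) -> f =1 g.
Proof.
move=> fl gl fg x; have := fg x.
have := fg ('i *: x + 0); rewrite fl gl !ReD fg.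
move=> /addIr; case: (f x) => a b; case: (g x) => c d /=.
rewrite !mul0r !mul1r !sub0r => /oppr_inj -> -> //.
Qed.

(** A minimising sequence of J x = |x|^2 - 2 Re (f x) is Cauchy by the
parallelogram law, in which the linear terms of J cancel; its limit represents f
by [near_minimizer]. *)
Lemma riesz (f : H -> R[i]) (C : R) :
  (forall (a : R[i]) u v, f (a *: u + v) = a * f u + f v) ->
  (forall x, nrm (f x : R[i]^o) <= C * nrm x) ->
  exists y, forall x, f x = hip y x.
Proof.
move=> flin fC.
pose J x := nrm x ^+ 2 - 2 * complex.Re (f x).
have ReC x : complex.Re (f x) <= C * nrm x.
  apply: le_trans (fC x); rewrite -lecR -nrmE.
  apply: le_trans (_ : `|(complex.Re (f x))%:C| <= _).
    exact/real_ler_norm/complex_realP/ex_intro.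
  rewrite [leRHS]normc_def normc_def lecR /= expr0n addr0.
  by rewrite ler_wsqrtr // lerDl sqr_ge0.
have Jlb x : - C ^+ 2 <= J x.
  by have := ReC x; have := sqr_ge0 (nrm x - C); rewrite /J; nra.
pose m := inf (range J).
have hinf : has_inf (range J).
  by split; [exists (J 0), 0 | exists (- C ^+ 2) => _ [x _ <-]].
have mJ x : m <= J x by apply: ge_inf; [case: hinf | exists x].
have hd (n : nat) : (0 : R) < n.+1%:R^-1 by rewrite invr_gt0.
have /choice[u uJ] n : exists x, J x <= m + n.+1%:R^-1.
  by have [_ [x _ <-] /ltW ?] := inf_adherent (hd n) hinf; exists x.
(* 2 J x + 2 J y - 4 J ((x + y) / 2) = |x - y|^2, and J is at least m at the
   midpoint. *)
have par x y : nrm (x - y) ^+ 2 <= 2 * (J x - m) + 2 * (J y - m).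
  have := mJ ((2^-1)%:C *: (x + y)).
  have e0 := flin (-1) 0 0; rewrite scaler0 addr0 mulN1r addNr in e0.
  have e := flin (2^-1)%:C (x + y) 0.
  have e' := flin 1 x y.
  rewrite e0 !addr0 in e; rewrite scale1r mul1r in e'.
  rewrite /J nrm_sqZ e e' nrm_sqD -(scaleN1r y).
  have -> : -1 = (-1 : R)%:C :> R[i] by rewrite rmorphN1.
  rewrite nrm_sqD nrm_sqZ ripZr.
  have -> : complex.Re ((2^-1)%:C * (f x + f y)) =
      2^-1 * (complex.Re (f x) + complex.Re (f y)).
    by case: (f x) => ? ?; case: (f y) => ? ? /=; rewrite mul0r subr0.
  lra.
have [y uy] : exists y : H, u @ \oo --> y.
  apply: nrm_complete => e e0.
  have [|N Nn] := eventually_inv_lt (e := e ^+ 2 / 4); first by rewrite divr_gt0 ?exprn_gt0.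
  exists N => i j Ni Nj.
  rewrite -(ltr_pXn2r (n := 2)) ?nnegrE ?nrm_ge0 ?(ltW e0) //.
  apply: le_lt_trans (par _ _) _.
  have := uJ i; have := uJ j; have := Nn _ Ni; have := Nn _ Nj.
  move: (J (u i)) (J (u j)) (i.+1%:R^-1) (j.+1%:R^-1) => Ji Jj di dj; lra.
exists y; apply: linear_eq_Re => // [a v w|z]; first by rewrite hipDr hipZr.
rewrite -[RHS]/(rip y z); apply/eqP; rewrite -subr_eq0 -normr_le0.
apply/ler_addgt0Pr => e e0; rewrite add0r.
set q := 1 + nrm z ^+ 2; have q1 : 1 <= q by rewrite lerDl sqr_ge0.
have q0 : 0 < q by lra.
have [|N Nn] := eventually_inv_lt (e := e ^+ 2 / 4 / q).
  by rewrite divr_gt0 ?divr_gt0 ?exprn_gt0.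
have /cvg_nrmP /(_ (e / 2 / q)) := uy.
case=> [|N' N'n]; first by rewrite divr_gt0 // divr_gt0.
pose n := maxn N N'.
have h1 := N'n n (leq_maxr _ _).
have h2 := Nn n (leq_maxl _ _).
have := near_minimizer z flin mJ (uJ n); rewrite -/q => h3.
have {}h3 : `|rip (u n) z - complex.Re (f z)| <= e / 2.
  rewrite -(ler_pXn2r (n := 2)) ?nnegrE ?normr_ge0 ?divr_ge0 ?(ltW e0) //.
  rewrite real_normK ?num_real //; apply: le_trans h3 _.
  rewrite ltr_pdivlMr // in h2; have -> : (e / 2) ^+ 2 = e ^+ 2 / 4 by field.
  exact: ltW.
have h4 : `|rip (u n) z - rip y z| <= e / 2.
  have -> : rip (u n) z - rip y z = rip (u n - y) z.
    by rewrite /rip hipBl; case: (hip (u n) z); case: (hip y z).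
  rewrite ltr_pdivlMr // in h1.
  have a1 := rip_le (u n - y) z.
  have a2 := rip_le (y - u n) z.
  rewrite nrm_distC in a2.
  have a3 : rip (y - u n) z = - rip (u n - y) z.
    by rewrite /rip !hipBl; case: (hip (u n) z) => ? ?; case: (hip y z) => ? ? /=; ring.
  have := nrm_ge0 z; have := nrm_ge0 (u n - y) => b1 b2.
  have b3 : nrm (u n - y) * nrm z <= nrm (u n - y) * q.
    by rewrite ler_wpM2l // /q; nra.
  rewrite ler_norml; apply/andP; split; lra.
have := ler_distD (rip (u n) z) (complex.Re (f z)) (rip y z).
rewrite (distrC _ (rip (u n) z)) => h5; apply: le_trans h5 _; lra.
Qed.

End Riesz.

(** * Bounded operators and adjoints *)

Section BoundedOps.
Variables (R : realType) (H K : hilbertType R).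
Implicit Types (T : H -> K).

Lemma bounded_opP T : bounded_op T <->
  (forall (a : R[i]) x y, T (a *: x + y) = a *: T x + T y) /\
  (exists2 C : R, 0 <= C & forall x, nrm (T x) <= C * nrm x).
Proof.
split=> -[Tl]; last first.
  move=> [C C0 TC]; split=> // x; apply/cvgrPdist_lt => _ /gt0_real_complex[e e0 ->].
  apply/nbhs_ballP; have d0 : 0 < e / (C + 1) by rewrite divr_gt0 // ltr_wpDl.
  exists (e / (C + 1))%:C; first by rewrite /= ltcR.
  move=> y; rewrite -ball_normE /ball_ /= !nrmE !ltcR => xy.
  have -> : T x - T y = T (x - y) by rewrite [LHS]addrC -scaleN1r -Tl scaleN1r addrC.
  apply: le_lt_trans (TC _) _; move: xy; rewrite ltr_pdivlMr ?ltr_wpDl // => xy.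
  by have := nrm_ge0 (x - y); nra.
move=> Tc; split=> //.
have T0 : T 0 = 0 by have := Tl (-1) 0 0; rewrite scaler0 add0r scaleN1r addNr.
have TZ a x : T (a *: x) = a *: T x by have := Tl a x 0; rewrite T0 !addr0.
have /cvgrPdist_lt /(_ 1 ltr01) /nbhs_ballP[_ /gt0_real_complex[d d0 ->] db] := Tc 0.
exists (2 / d) => [|x]; first by rewrite divr_ge0 // ltW.
have [->|x0] := eqVneq x 0; first by rewrite T0 !nrm0 mulr0.
have {}x0 := nrm_gt0 x0.
set s := d / 2 / nrm x.
have s0 : 0 < s by rewrite !divr_gt0.
have ns : complex.Re `|s%:C| = s by rewrite ger0_norm // ler0c ltW.
have : nrm (T (s%:C *: x)) < 1.
  have := db (s%:C *: x); rewrite -ball_normE /ball_ /= T0 !sub0r !normrN !nrmE ltcR.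
  rewrite ltcR; apply; rewrite nrmZ ns /s divfK ?gt_eqF //; lra.
rewrite TZ nrmZ ns => /ltW h.
rewrite -(ler_pM2l s0); apply: le_trans h _; rewrite /s.
suff -> : d / 2 / nrm x * (2 / d * nrm x) = 1 by [].
by field; rewrite !gt_eqF.
Qed.

Lemma bounded_op_lin T : bounded_op T ->
  forall (a : R[i]) x y, T (a *: x + y) = a *: T x + T y.
Proof. by case. Qed.

Lemma bounded_op0 T : bounded_op T -> T 0 = 0.
Proof.
by move=> [Tl _]; have := Tl (-1) 0 0; rewrite scaler0 add0r scaleN1r addNr.
Qed.

Lemma bounded_opZ T : bounded_op T -> forall (a : R[i]) x, T (a *: x) = a *: T x.
Proof. by move=> Tb a x; have := bounded_op_lin Tb a x 0; rewrite bounded_op0 // !addr0. Qed.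

Lemma opnorm_le T (C : R) : (forall x, nrm (T x) <= C * nrm x) -> 0 <= C -> opnorm T <= C.
Proof.
move=> TC C0; apply: ge_sup.
  by exists (nrm (T 0)), 0 => //=; rewrite normr0.
move=> _ [x /= x1 <-]; apply: le_trans (TC x) _.
by rewrite ler_piMr // -lecR -nrmE.
Qed.

Lemma opnorm_ub T x : bounded_op T -> nrm (T x) <= opnorm T * nrm x.
Proof.
move=> Tb; have /bounded_opP[Tl [C C0 TC]] := Tb.
have ub y : nrm y <= 1 -> nrm (T y) <= opnorm T.
  move=> y1; apply: ub_le_sup.
    exists C => _ [z /= z1 <-]; apply: le_trans (TC z) _.
    by rewrite ler_piMr // -lecR -nrmE.
  by exists y => //=; rewrite nrmE lecR.
have [->|x0] := eqVneq x 0; first by rewrite bounded_op0 // !nrm0 mulr0.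
have {}x0 := nrm_gt0 x0.
have s0 : 0 <= (nrm x)^-1 by rewrite invr_ge0 ltW.
have ns : complex.Re `|(nrm x)^-1%:C| = (nrm x)^-1 by rewrite ger0_norm // ler0c.
have := ub ((nrm x)^-1%:C *: x); rewrite bounded_opZ // !nrmZ ns.
by rewrite mulVf ?gt_eqF // => /(_ (lexx _)); rewrite ler_pdivrMl // mulrC.
Qed.

Lemma opnorm_ge0 T : bounded_op T -> 0 <= opnorm T.
Proof.
move=> Tb; have /bounded_opP[Tl [C C0 TC]] := Tb.
rewrite -(nrm0 K) -(bounded_op0 Tb); apply: ub_le_sup.
  exists C => _ [z /= z1 <-]; apply: le_trans (TC z) _.
  by rewrite ler_piMr // -lecR -nrmE.
by exists 0 => //=; rewrite normr0.
Qed.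

End BoundedOps.

Section Adjoints.
Variables (R : realType) (H K : hilbertType R).
Implicit Types (T : H -> K).

Lemma adjoint_exists T : bounded_op T -> exists S : K -> H, is_adjoint T S.
Proof.
move=> Tb; have /choice[S SP] (y : K) : exists z : H, forall x, hip y (T x) = hip z x.
  apply: (@riesz _ _ _ (nrm y * opnorm T)).
    by move=> a u v; rewrite bounded_op_lin // hipDr hipZr.
  move=> x; apply: le_trans (cauchy_schwarz _ _) _.
  by rewrite -mulrA ler_wpM2l ?nrm_ge0 // opnorm_ub.
by exists S => x y; rewrite hipC SP -hipC.
Qed.

(** Chosen classically so that the inner product of operators is a total
function; the value 0 is a junk value for T without an adjoint. *)
Definition adjoint T : K -> H := xget (fun=> 0) (is_adjoint T).

Lemma adjointP T : bounded_op T -> is_adjoint T (adjoint T).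
Proof. by move=> /adjoint_exists [S TS]; exact: (xgetI _ TS). Qed.

Lemma is_adjoint_sym T (S : K -> H) : is_adjoint T S -> is_adjoint S T.
Proof. by move=> TS x y; rewrite hipC -TS -hipC. Qed.

(** |S y|^2 = <T (S y), y> <= |T| |S y| |y|. *)
Lemma bounded_is_adjoint T (S : K -> H) :
  bounded_op T -> is_adjoint T S -> bounded_op S.
Proof.
move=> Tb TS; apply/bounded_opP; split=> [a x y|].
  by apply: hip_sep => z; rewrite -TS !hipDr !hipZr !TS.
exists (opnorm T) => [|y]; first exact: opnorm_ge0.
have [Sy0|] := eqVneq (nrm (S y)) 0.
  by rewrite Sy0 mulr_ge0 ?opnorm_ge0 ?nrm_ge0.
move=> Sy0; have {}Sy0 : 0 < nrm (S y) by rewrite lt_def nrm_ge0 Sy0.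
rewrite -(ler_pM2r Sy0) -expr2 rip_nrm /rip -TS.
apply: le_trans (rip_le _ _) _; rewrite mulrAC.
by rewrite ler_wpM2r ?nrm_ge0 // opnorm_ub.
Qed.

Lemma bounded_adjoint T : bounded_op T -> bounded_op (adjoint T).
Proof. by move=> Tb; exact: bounded_is_adjoint (adjointP Tb). Qed.

Lemma bounded_op_lincomb T (S : H -> K) (a : R[i]) : bounded_op T -> bounded_op S ->
  bounded_op (a *: T + S).
Proof.
move=> /bounded_opP[Tl [C C0 TC]] /bounded_opP[Sl [D D0 SD]]; apply/bounded_opP.
split=> [b x y|].
  have e v : (a *: T + S) v = a *: T v + S v by [].
  rewrite !e Tl Sl !scalerDr !scalerA (mulrC a b) -!addrA.
  by congr (_ + _); rewrite addrCA.
have na : (0 : R) <= complex.Re `|a| by exact: (@nrm_ge0 R (R[i]^o) a).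
exists (complex.Re `|a| * C + D) => [|x]; first by rewrite addr_ge0 ?mulr_ge0.
apply: le_trans (nrmD _ _) _; rewrite mulrDl lerD // nrmZ -mulrA.
by rewrite ler_wpM2l.
Qed.

Lemma bounded_opB T (S : H -> K) : bounded_op T -> bounded_op S -> bounded_op (T - S).
Proof. by move=> Tb Sb; rewrite addrC -scaleN1r; exact: bounded_op_lincomb. Qed.

End Adjoints.

Lemma bounded_comp (R : realType) (H K L : hilbertType R) (S : K -> L) (T : H -> K) :
  bounded_op S -> bounded_op T -> bounded_op (S \o T).
Proof.
move=> [Sl Sc] [Tl Tc]; split=> [a x y|x]; first by rewrite /= Tl Sl.
exact: continuous_comp (Tc x) (Sc _).
Qed.

(** The C*-identity: |T^* y|^2 = <T T^* y, y> with y = T x bounds T^* T by |T|^2,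
and |T x|^2 = <x, T^* T x> gives the converse. *)
Lemma opnorm_adjoint_comp (R : realType) (H K : hilbertType R) (T : H -> K) :
  bounded_op T -> opnorm T = Num.sqrt (opnorm (adjoint T \o T)).
Proof.
move=> Tb; have Ab := bounded_comp (bounded_adjoint Tb) Tb.
have sqT x : nrm (T x) ^+ 2 = rip x ((adjoint T \o T) x).
  by rewrite rip_nrm /rip /= (adjointP Tb).
apply/eqP; rewrite -(eqrXn2 (n := 2)) ?sqrtr_ge0 ?opnorm_ge0 // sqr_sqrtr ?opnorm_ge0 //.
rewrite eq_le; apply/andP; split; last first.
  apply: opnorm_le => [x|]; last exact: sqr_ge0.
  have := opnorm_ub x Tb; set y := T x => Tx; rewrite /= -/y.
  have [Sy0|] := eqVneq (nrm (adjoint T y)) 0.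
    by rewrite Sy0 mulr_ge0 ?sqr_ge0 ?nrm_ge0.
  move=> Sy0; have {}Sy0 : 0 < nrm (adjoint T y) by rewrite lt_def nrm_ge0 Sy0.
  have h1 : nrm (adjoint T y) ^+ 2 <= nrm (T (adjoint T y)) * nrm y.
    by rewrite rip_nrm /rip -(adjointP Tb); exact: rip_le.
  have h2 := opnorm_ub (adjoint T y) Tb.
  have t0 := opnorm_ge0 Tb; have x0 := nrm_ge0 x; have y0 := nrm_ge0 y.
  rewrite -(ler_pM2r Sy0) -expr2; apply: le_trans h1 _.
  apply: le_trans (ler_pM (nrm_ge0 _) (nrm_ge0 _) h2 Tx) _.
  by rewrite le_eqVlt; apply/orP; left; apply/eqP; ring.
rewrite -(sqr_sqrtr (opnorm_ge0 Ab)) ler_pXn2r ?nnegrE ?sqrtr_ge0 ?opnorm_ge0 //.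
apply: opnorm_le => [x|]; last exact: sqrtr_ge0.
rewrite -(ler_pXn2r (n := 2)) ?nnegrE ?mulr_ge0 ?sqrtr_ge0 ?nrm_ge0 //.
rewrite exprMn sqr_sqrtr ?opnorm_ge0 // sqT.
apply: le_trans (rip_le _ _) _; rewrite mulrC expr2 mulrA.
by rewrite ler_wpM2r ?nrm_ge0 // opnorm_ub.
Qed.

(** * Extension of isometries from a spanning set *)

Section Isometry.
Variables (R : realType) (K L : hilbertType R).
Implicit Types (G : set (K * L)%type).

(** Compatibility with the inner products extends from a set of pairs to its
span, since it is sesquilinear in the two pairs. *)
Lemma lspan_isometric G :
  (forall p q, G p -> G q -> hip p.1 q.1 = hip p.2 q.2) ->
  forall p q, lspan G p -> lspan G q -> hip p.1 q.1 = hip p.2 q.2.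
Proof.
move=> Gpq.
have half p : G p -> lspan G `<=` [set q | hip p.1 q.1 = hip p.2 q.2].
  move=> Gp; apply: lspan_sub => [|q]; last exact: Gpq.
  split; first by rewrite /= !hip0r.
  by move=> a v w /= vE wE; rewrite !hipDr !hipZr vE wE.
move=> p q Gp Gq; move: p Gp; apply: lspan_sub; last by move=> p /half; apply.
split; first by rewrite /= !hip0l.
by move=> a v w /= vE wE; rewrite !hipDl !hipZl vE wE.
Qed.

(** A correspondence G between vectors of K and L which preserves inner products
spans the graph of an isometry on the span of the first components.  The
span is taken in K x L, so that linear combinations on the two sides correspond,
and isometry makes the second components converge whenever the first ones do. *)
Lemma isometry_extension G :
  (forall p q, G p -> G q -> hip p.1 q.1 = hip p.2 q.2) ->
  dense (lspan [set p.1 | p in G]) ->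
  exists U : K -> L, [/\ bounded_op U, forall p, G p -> U p.1 = p.2 &
    forall x y, hip (U x) (U y) = hip x y].
Proof.
move=> /lspan_isometric Gpq Gd.
have lsub : Defs.subspace (lspan G).
  split; first by move=> D [[]].
  move=> a p q Gp Gq D [Ds GD]; by apply: Ds.2; [apply: Gp|apply: Gq].
have lift : lspan [set p.1 | p in G] `<=` [set x | exists y, lspan G (x, y)].
  apply: lspan_sub => [|_ [p Gp <-]]; last first.
    exists p.2; rewrite -surjective_pairing => D [_ GD]; exact: GD.
  split; first by exists 0; case: lsub.
  by move=> a x x' [y Gxy] [y' Gxy']; exists (a *: y + y'); exact: (lsub.2 a _ _ Gxy Gxy').
have /choice[U UP] (x : K) : exists y : L, exists2 p : nat -> (K * L)%type, 
    (forall n, lspan G (p n)) &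
    ((fst \o p) @ \oo --> x) /\ ((snd \o p) @ \oo --> y).
  have [u uS ux] := dense_cvg x Gd.
  have /choice[v vP] (n : nat) : exists y : L, lspan G (u n, y) by exact: lift.
  have [y vy] : exists y : L, v @ \oo --> y.
    apply: nrm_complete => e e0; have /cvg_nrmP /(_ (e / 2)) := ux.
    case=> [|N Nu]; first by rewrite divr_gt0.
    exists N => m n Nm Nn.
    have -> : nrm (v m - v n) = nrm (u m - u n).
      apply/eqP; rewrite -(eqrXn2 (n := 2)) ?nrm_ge0 //.
      have /eqP := Gpq (-1 *: (u n, v n) + (u m, v m)) (-1 *: (u n, v n) + (u m, v m))
        (lsub.2 _ _ _ (vP n) (vP m)) (lsub.2 _ _ _ (vP n) (vP m)).
      rewrite /= !hip_nrm !scaleN1r ![- _ + _]addrC => /eqP/complexI ->.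
      by [].
    have h1 := Nu m Nm; have h2 := Nu n Nn.
    have := nrm_dist_trans x (u m) (u n); rewrite (nrm_distC x) => h3.
    apply: le_lt_trans h3 _; lra.
  by exists y, (fun n => (u n, v n)).
(* Passing to the limit in one variable at a time avoids the joint continuity
   of the inner product. *)
have EU q x : lspan G q -> hip q.2 (U x) = hip q.1 x.
  move=> Gq; have [p Gp [px pU]] := UP x.
  apply: cvgC_uniq (cvg_hipr q.2 pU) _ => /=.
  under [X in X @ _]eq_fun do rewrite -Gpq //.
  exact: cvg_hipr px.
have UU x y : hip (U x) (U y) = hip x y.
  have [p Gp [px pU]] := UP x.
  apply: cvgC_uniq (cvg_hipl (U y) pU) _ => /=.
  under [X in X @ _]eq_fun do rewrite EU //.
  exact: cvg_hipl px.
have Unrm x : nrm (U x) = nrm x.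
  have /eqP := UU x x; rewrite !hip_nrm => /eqP/complexI/eqP.
  by rewrite eqrXn2 ?nrm_ge0 // => /eqP.
exists U; split => // [|p Gp].
  apply/bounded_opP; split; last by exists 1 => // x; rewrite mul1r Unrm.
  move=> a x y; apply/subr0_eq/hip_eq0; set z := U _ - _.
  have zU w : hip z (U w) = 0.
    by rewrite hipBl hipDl hipZl !UU hipDl hipZl subrr.
  by rewrite {2}/z hipBr hipDr hipZr !zU mulr0 addr0 subr0.
have {}Gp : lspan G p by move=> D [_]; apply.
apply/subr0_eq/hip_eq0; rewrite hipBl !hipBr UU (hipC (U _)) !EU // -Gpq //.
by rewrite -hipC !subrr.
Qed.

End Isometry.

(** * Norm completeness of the bounded operators *)

Section BoundedComplete.
Variables (R : realType) (H K : hilbertType R).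
Implicit Types (T : H -> K) (u : nat -> H -> K).

(** The limit is taken pointwise; the uniform estimate for u n - T comes from
letting m go to infinity in the Cauchy estimate for u n - u m. *)
Lemma bounded_op_complete u : (forall n, bounded_op (u n)) ->
  (forall e : R, 0 < e -> exists N, forall m n, (N <= m)%N -> (N <= n)%N ->
     opnorm (u m - u n) < e) ->
  exists2 T, bounded_op T & opnorm (u n - T) @[n --> \oo] --> (0 : R).
Proof.
move=> ub uC.
have pw e m n x : opnorm (u m - u n) < e -> nrm (u m x - u n x) <= e * nrm x.
  move=> /ltW h; apply: le_trans (opnorm_ub x (bounded_opB (ub m) (ub n))) _.
  by rewrite ler_wpM2r ?nrm_ge0.
have /choice[T TP] (x : H) : exists y : K, (fun n => u n x) @ \oo --> y.
  apply: nrm_complete => e e0; have x0 : 0 < nrm x + 1 by rewrite ltr_wpDl ?nrm_ge0.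
  have [N Nu] := uC _ (divr_gt0 e0 x0); exists N => m n Nm Nn.
  apply: le_lt_trans (pw _ m n x (Nu m n Nm Nn)) _.
  by rewrite mulrAC ltr_pdivrMr // ltr_pM2l // ltrDl.
have Tl (a : R[i]) x y : T (a *: x + y) = a *: T x + T y.
  apply: cvg_uniq (TP _) _.
  under [X in X @ _]eq_fun do rewrite bounded_op_lin //.
  by apply: cvgD; [apply: cvgZr; exact: TP|exact: TP].
have uT (e : R) : 0 < e -> exists N, forall n, (N <= n)%N ->
    forall x, nrm ((u n - T) x) <= e * nrm x.
  move=> e0; have [N Nu] := uC _ e0; exists N => n Nn x.
  apply/ler_addgt0Pr => d d0; have /cvg_nrmP /(_ d d0)[N' N'u] := TP x.
  have h1 := pw _ _ _ x (Nu n (maxn N N') Nn (leq_maxl _ _)).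
  have h2 := N'u _ (leq_maxr N N').
  by apply: le_trans (nrm_dist_trans (u (maxn N N') x) _ _) _; rewrite lerD // ltW.
have Db n : bounded_op (u n - T) -> bounded_op T.
  by move=> h; have := bounded_opB (ub n) h; rewrite opprB addrC subrK.
have DT (e : R) : 0 < e -> exists N, forall n, (N <= n)%N ->
    bounded_op (u n - T) /\ opnorm (u n - T) <= e.
  move=> e0; have [N Nu] := uT _ e0; exists N => n /Nu h; split; last first.
    by apply: opnorm_le => //; exact: ltW.
  apply/bounded_opP; split; last by exists e => //; exact: ltW.
  move=> a x y; have E v : (u n - T) v = u n v - T v by [].
  by rewrite !E bounded_op_lin // Tl scalerBr opprD addrACA.
exists T; first by have [N /(_ N (leqnn N))[/Db]] := DT 1 ltr01.
apply/cvgrPdist_lt => e e0; have e20 : 0 < e / 2 by rewrite divr_gt0.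
have [N Nu] := DT _ e20.
exists N => // n /= /Nu [b h]; rewrite sub0r normrN ger0_norm ?opnorm_ge0 //.
by apply: le_lt_trans h _; rewrite ltr_pdivrMr // ltr_pMr // ltr1n.
Qed.

Lemma opnorm_cvg_wot u T : (forall n, bounded_op (u n)) -> bounded_op T ->
  opnorm (u n - T) @[n --> \oo] --> (0 : R) -> wot_cvg u T.
Proof.
move=> ub Tb /cvgrPdist_lt uT x y; apply: (cvg_hipr y); apply/cvg_nrmP => e e0.
have x0 : 0 < nrm x + 1 by rewrite ltr_wpDl ?nrm_ge0.
have [N _ Nu] := uT _ (divr_gt0 e0 x0); exists N => n /Nu /=.
rewrite sub0r normrN ger0_norm; last exact: opnorm_ge0 (bounded_opB (ub n) Tb).
rewrite ltr_pdivlMr // => h.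
apply: le_lt_trans (opnorm_ub x (bounded_opB (ub n) Tb)) _.
by apply: le_lt_trans h; rewrite ler_wpM2l ?lerDl // opnorm_ge0 //; exact: bounded_opB.
Qed.

End BoundedComplete.

(** * Weak operator limits and sequential closures *)

Section Wot.
Variables (R : realType) (H K : hilbertType R).
Implicit Types (T S : H -> K) (u v : nat -> H -> K).

Lemma wot_cvg_cst T : wot_cvg (fun=> T) T.
Proof. by move=> x y; exact: cvg_cst. Qed.

Lemma wot_cvg_lincomb (a : R[i]) u v T S : wot_cvg u T -> wot_cvg v S ->
  wot_cvg (fun n => a *: u n + v n) (a *: T + S).
Proof.
move=> uT vS x y.
have E (T' S' : H -> K) : hip y ((a *: T' + S') x) = a * hip y (T' x) + hip y (S' x).
  by rewrite -hipZr -hipDr.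
rewrite E; under [X in X @ _]eq_fun do rewrite E.
by apply: (@cvgD _ R[i]^o); [apply: (@cvgMr R[i]); exact: uT|exact: vS].
Qed.

Lemma wot_cvg_hipl u T x y : wot_cvg u T ->
  (fun n => hip (u n x) y : R[i]^o) @ \oo --> (hip (T x) y : R[i]^o).
Proof.
move=> /(_ x y) /cvg_conjc; rewrite -hipC.
by under [X in X @ _]eq_fun do rewrite -hipC.
Qed.

Lemma wot_cvg_adjoint_compl S u T : bounded_op S -> wot_cvg u T ->
  wot_cvg (fun n => adjoint S \o u n) (adjoint S \o T).
Proof.
move=> Sb uT x y; rewrite /= -(adjointP Sb).
by under [X in X @ _]eq_fun do rewrite /= -(adjointP Sb); exact: uT.
Qed.

(** Conjugation is what makes T |-> T^* S continuous: <y, T^* S x> is the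
conjugate of <S x, T y>. *)
Lemma wot_cvg_adjoint_compr S u T : (forall n, bounded_op (u n)) -> bounded_op T ->
  wot_cvg u T -> wot_cvg (fun n => adjoint (u n) \o S) (adjoint T \o S).
Proof.
move=> ub Tb uT x y; rewrite /= -(adjointP Tb).
under [X in X @ _]eq_fun do rewrite /= -(adjointP (ub _)).
exact: wot_cvg_hipl.
Qed.

Lemma bounded_op_wot_closed : wot_seq_closed (@bounded_op R H K).
Proof. by split. Qed.

Section Closure.
Variable S : set (H -> K).
Hypothesis Sb : S `<=` @bounded_op R H K.
Local Notation M := (wot_seq_closure S).

Lemma sub_wot_closure : S `<=` M.
Proof. exact: sub_smallest. Qed.

Lemma wot_closure_bounded : M `<=` @bounded_op R H K.
Proof. by apply: smallest_sub => //; exact: bounded_op_wot_closed. Qed.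

Lemma wot_closure_closed : wot_seq_closed M.
Proof.
split=> [|u T uM Tb uT D [Dc SD]]; first exact: wot_closure_bounded.
by apply: Dc.2 uT => // n; apply: uM.
Qed.

(** Induction along the closure: the members of M satisfying P form a WOT
sequentially closed set. *)
Lemma wot_closure_ind (P : set (H -> K)) : S `<=` P ->
  (forall u T, (forall n, M (u n)) -> (forall n, P (u n)) -> M T ->
     wot_cvg u T -> P T) ->
  M `<=` P.
Proof.
move=> SP PT; suff : M `<=` M `&` P by move=> MMP T /MMP[].
apply: smallest_sub => [|T ST]; last by split; [exact: sub_wot_closure|exact: SP].
split=> [T [MT _]|u T uMP Tb uT]; first exact: wot_closure_bounded.
have uM n : M (u n) by case: (uMP n).
have MT : M T by apply: wot_closure_closed.2 uT.
by split=> //; apply: PT uT => // n; case: (uMP n).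
Qed.

(** Limits are taken in one of the two operators at a time, hence two inductions. *)
Lemma wot_closure_subspace : Defs.subspace S -> Defs.subspace M.
Proof.
move=> [S0 SD]; split; first exact: sub_wot_closure.
have half (a : R[i]) T U : S T -> M U -> M (a *: T + U).
  move=> ST; move: U; apply: wot_closure_ind => [U SU|u U uM uP MU uU].
    by apply: sub_wot_closure; exact: SD.
  have aU := wot_cvg_lincomb (a := a) (wot_cvg_cst (T := T)) uU.
  apply: wot_closure_closed.2 aU => //.
  by apply: bounded_op_lincomb; [exact: Sb|exact: wot_closure_bounded].
move=> a T U MT MU; move: T MT.
apply: wot_closure_ind => [T ST|u T uM uP MT uT]; first exact: half.
have aT := wot_cvg_lincomb (a := a) uT (wot_cvg_cst (T := U)).
apply: wot_closure_closed.2 aT => //.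
by apply: bounded_op_lincomb; exact: wot_closure_bounded.
Qed.

Lemma wot_closure_comp (b : H -> H) : bounded_op b ->
  (forall T, S T -> S (T \o b)) -> forall T, M T -> M (T \o b).
Proof.
move=> bb Sb'; apply: wot_closure_ind => [T ST|u T uM uP MT uT].
  by apply: sub_wot_closure; exact: Sb'.
have ub : wot_cvg (fun n => u n \o b) (T \o b) by move=> x y; exact: uT.
apply: wot_closure_closed.2 uP _ ub.
by apply: bounded_comp => //; exact: wot_closure_bounded.
Qed.

(** The hypothesis that B is WOT sequentially closed enters here, in the two
inductions on U and then on T. *)
Lemma wot_closure_inner (B : set (H -> H)) : wot_seq_closed B ->
  (forall T U, S T -> S U -> B (adjoint T \o U)) ->
  forall T U, M T -> M U -> B (adjoint T \o U).
Proof.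
move=> Bc SB.
have ab T U : M T -> M U -> bounded_op (adjoint T \o U).
  move=> /wot_closure_bounded Tb /wot_closure_bounded Ub.
  by apply: bounded_comp => //; exact: bounded_adjoint.
have half T U : S T -> M U -> B (adjoint T \o U).
  move=> ST; have MT := sub_wot_closure ST.
  move: U; apply: wot_closure_ind => [U SU|u U uM uP MU uU]; first exact: SB.
  have aU := wot_cvg_adjoint_compl (Sb ST) uU.
  by apply: Bc.2 aU => //; exact: ab.
move=> T U MT MU; move: T MT.
apply: wot_closure_ind => [T ST|u T uM uP MT uT]; first exact: half.
have ub n : bounded_op (u n) by exact: wot_closure_bounded.
have aT := wot_cvg_adjoint_compr (S := U) ub (wot_closure_bounded MT) uT.
by apply: Bc.2 aT => //; exact: ab.
Qed.

End Closure.
End Wot.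

(** * Weakly sequentially closed modules of operators *)

Section OperatorModule.
Variables (R : realType) (H K : hilbertType R) (B : set (H -> H)).
Variable M : set (H -> K).
Local Notation comp := (fun (T : H -> K) (b : H -> H) => T \o b).
Local Notation ipM := (fun T U : H -> K => adjoint T \o U).
Hypothesis Mc : wot_seq_closed M.
Hypothesis Msub : Defs.subspace M.
Hypothesis (MB : forall T b, M T -> B b -> M (T \o b)).
Hypothesis (MM : forall T U, M T -> M U -> B (adjoint T \o U)).
Hypothesis (Md : dense (lspan [set z : K | exists2 T, M T & exists h, z = T h])).

Lemma operator_cstar_module : is_cstar_module B M comp ipM.
Proof.
have Mb T : M T -> bounded_op T by case: Mc => + _; exact.
split => //.
- move=> a T b c MT Bb BC; apply/funext => x /=; exact: (bounded_op_lin (Mb _ MT)).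
- move=> a T U W MT MU MW; apply/funext => x /=.
  exact: (bounded_op_lin (bounded_adjoint (Mb _ MT))).
- move=> T U MT MU x y; rewrite /= (is_adjoint_sym (adjointP (Mb _ MT))).
  exact/adjointP/Mb.
- move=> T MT h; rewrite -(adjointP (Mb _ MT)) hip_nrm ler0c; exact: sqr_ge0.
- move=> T MT T0; apply/funext => x; apply: hip_eq0.
  by rewrite (adjointP (Mb _ MT)) -[adjoint T (T x)]/((adjoint T \o T) x) T0 hip0r.
- move=> u uM uC.
  have MB' T U : M T -> M U -> M (T - U).
    by move=> MT MU; rewrite addrC -scaleN1r; exact: Msub.2.
  have nE T : M T -> cstar_norm ipM T = opnorm T.
    by move=> MT; rewrite /cstar_norm -opnorm_adjoint_comp //; exact: Mb.
  have ub n := Mb _ (uM n).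
  have [|T Tb uT] := bounded_op_complete ub.
    by move=> e /uC[N Nu]; exists N => m n Nm Nn; rewrite -nE; [exact: Nu|exact: MB'].
  have MT : M T by apply: Mc.2 (opnorm_cvg_wot ub Tb uT).
  exists T => //.
  have -> : (fun n => cstar_norm ipM (u n - T)) = (fun n => opnorm (u n - T)).
    by apply/funext => n; apply: nE; exact: MB'.
  exact: uT.
Qed.

(** Elements of M already act from H to K with dense joint range, so a model of
the tensor product is at hand and no completion has to be constructed. *)
Lemma operator_tensor : is_tensor B M comp ipM (fun T h => T h).
Proof.
have Mb T : M T -> bounded_op T by case: Mc => + _; exact.
split => //; first by move=> a T h k MT; exact: (bounded_op_lin (Mb _ MT)).
by move=> T U h k MT MU; exact: (adjointP (Mb _ MT)).
Qed.

(** Any other tensor product L receives an isometry U from K, which transports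
weak limits in B(H, L) back to B(H, K) through its adjoint. *)
Lemma operator_sigma_module : is_sigma_module B M comp ipM.
Proof.
have Mb T : M T -> bounded_op T by case: Mc => + _; exact.
split; first exact: operator_cstar_module.
  by exists K, (fun T h => T h); exact: operator_tensor.
move=> L t [tl tr tb tip td].
have tbd T : M T -> bounded_op (t T).
  move=> MT; apply/bounded_opP; split; first by move=> *; exact: tr.
  exists (opnorm T) => [|x]; first exact/opnorm_ge0/Mb.
  have -> : nrm (t T x) = nrm (T x).
    apply/eqP; rewrite -(eqrXn2 (n := 2)) ?nrm_ge0 // !rip_nrm /rip tip //.
    by rewrite (adjointP (Mb _ MT)).
  exact/opnorm_ub/Mb.
split=> [_ [T MT <-]|s S sM Sb sS]; first exact: tbd.
have /choice[u uP] n : exists T, M T /\ t T = s n.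
  by have [T MT <-] := sM n; exists T.
have uM n : M (u n) by case: (uP n).
pose G := [set p : (K * L)%type | exists2 T, M T & exists h, p = (T h, t T h)].
have [||U [Ub UG UU]] := @isometry_extension R K L G.
- move=> _ _ [T MT [h ->]] [T' MT' [h' ->]] /=.
  by rewrite tip // (adjointP (Mb _ MT)).
- apply: dense_mono Md; apply: lspan_mono => _ [T MT [h ->]].
  by exists (T h, t T h) => //; exists T => //; exists h.
have tU T h : M T -> U (T h) = t T h.
  by move=> MT; apply: (UG (T h, t T h)); exists T => //; exists h.
pose T := adjoint U \o S.
have Tb : bounded_op T by apply: bounded_comp => //; exact: bounded_adjoint.
(* S need not take its values in the range of U a priori, so T is defined with
   the adjoint of U; that it induces S is checked on the dense span in L. *)
have hT k h : hip k (T h) = hip (U k) (S h) by rewrite (adjointP Ub).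
have MT : M T.
  apply: (Mc.2 u) => // h k; rewrite hT.
  under [X in X @ _]eq_fun do rewrite -UU tU // (uP _).2.
  exact: sS.
exists T => //; apply/funext => h; apply: dense_hip_ext td _.
move=> _ [T' MT' [h' ->]].
by rewrite tip // -[hip _ _]/(hip h' (adjoint T' (T h))) -(adjointP (Mb _ MT')) hT tU.
Qed.

End OperatorModule.

(** * Completing a module by weak sequential limits *)

Theorem theorem3p12 (R : realType) (H : hilbertType R) (B : set (H -> H))
    (X : lmodType R[i]) (act : X -> (H -> H) -> X) (ip : X -> X -> H -> H)
    (K : hilbertType R) (t : X -> H -> K) :
  is_sigma_algebra B ->
  is_cstar_module B [set: X] act ip ->
  is_tensor B [set: X] act ip t ->
  let BX : set (H -> K) := wot_seq_closure (range t) in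
  let comp (T : H -> K) (b : H -> H) : H -> K := T \o b in
  exists ipB : (H -> K) -> (H -> K) -> H -> H,
  [/\ is_sigma_module B BX comp ipB,
      is_submodule_embedding B [set: X] act ip BX comp ipB t,
      wotB_seq_dense BX ipB (range t),
      forall (T : H -> K) (x : X), BX T ->
        exists2 S : K -> H, is_adjoint T S &
          forall h, S (t x h) = ipB T (t x) h
    & forall T : H -> K, BX T -> opnorm T = cstar_norm ipB T].
Proof.
move=> [Bcs Bnd Bc] Xm Xt BX comp.
have tb : range t `<=` @bounded_op R H K.
  move=> _ [x _ <-]; apply/bounded_opP.
  split; first by move=> a h k; exact: (tensor_linr Xt).
  have Bxx : B (ip x x) by exact: (cmod_ip Xm).
  have bxx := Bc.1 _ Bxx.
  exists (Num.sqrt (opnorm (ip x x))) => [|h]; first exact: sqrtr_ge0.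
  rewrite -(ler_pXn2r (n := 2)) ?nnegrE ?mulr_ge0 ?sqrtr_ge0 ?nrm_ge0 //.
  rewrite exprMn sqr_sqrtr ?opnorm_ge0 // rip_nrm /rip (tensor_ip Xt) //.
  apply: le_trans (rip_le _ _) _; rewrite mulrC expr2 mulrA.
  by rewrite ler_wpM2r ?nrm_ge0 // opnorm_ub.
have tip x y : adjoint (t x) \o t y = ip x y.
  apply/funext => h; apply: hip_sep => k; rewrite -(tensor_ip Xt) //.
  by rewrite -(adjointP (tb _ _)) //; exists x.
have BXb := wot_closure_bounded tb.
have BXc : wot_seq_closed BX := wot_closure_closed tb.
have tBX x : BX (t x) by apply: sub_wot_closure; exists x.
have tlin (a : R[i]) x y : t (a *: x + y) = a *: t x + t y.
  by apply/funext => h; exact: (tensor_linl Xt).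
have BXsub : Defs.subspace BX.
  apply: wot_closure_subspace => //; split.
    by exists 0 => //; have := tlin (-1) 0 0; rewrite scaler0 add0r scaleN1r addNr.
  by move=> a _ _ [x _ <-] [y _ <-]; exists (a *: x + y).
exists (fun T U => adjoint T \o U); split.
- apply: operator_sigma_module => //.
  + move=> T b BT Bb; apply: (wot_closure_comp tb) BT; first exact: Bc.1.
    move=> _ [x _ <-]; exists (act x b) => //; apply/funext => h.
    exact: (tensor_balanced Xt).
  + apply: wot_closure_inner => // _ _ [x _ <-] [y _ <-]; rewrite tip.
    exact: (cmod_ip Xm).
  + apply: dense_mono (tensor_dense Xt); apply: lspan_mono => _ [x _ [h ->]].
    by exists (t x) => //; exists h.
- split=> //.
  + move=> x y _ _ txy; apply/subr0_eq/(cmod_ip_eq0 Xm) => //.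
    rewrite -tip; suff -> : t (x - y) = 0.
      by apply/funext => h; exact: bounded_op0 (bounded_adjoint (BXb _ BXsub.1)).
    by rewrite addrC -scaleN1r tlin txy scaleN1r addNr.
  + by move=> x b _ Bb; apply/funext => h; exact: (tensor_balanced Xt).
- move=> E tE EBX Ec; apply/seteqP; split=> //.
  apply: smallest_sub => //; split=> [T /EBX/BXb //|u T uE Tb uT].
  have BT : BX T by apply: BXc.2 uT => // n; exact: EBX.
  have ub n : bounded_op (u n) by apply: BXb; exact: EBX.
  by apply: Ec uE BT _ => U BU; exact: wot_cvg_adjoint_compr.
- move=> T x BT; exists (adjoint T) => //; exact/adjointP/BXb.
- by move=> T BT; apply: opnorm_adjoint_comp; exact: BXb.
Qed.
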